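(* Let $(X,Y)$ be a random vector with values in $\mathbb{R}^2$ and let $(X_1,Y_1),\dots,(X_4,Y_4)$ be i.i.d. copies of $(X,Y)$. If $X$ and $Y$ are independent, then $\sigma_1^2 = \operatorname{Var}[h_1(X_1,Y_1)] = 0$, so that $h_1(X_1,Y_1)$ is a degenerate (i.e. almost surely constant) random variable.
   Context: For $z_1,\dots,z_4\in\mathbb{R}$ let $$a(z_1,z_2,z_3,z_4) = I(z_1,z_3<z_2,z_4) + I(z_1,z_3>z_2,z_4) - I(z_1,z_2<z_3,z_4) - I(z_1,z_2>z_3,z_4),$$ where $I(\cdot)$ is the indicator function, $p,q<r,s$ is shorthand for $\max(p,q)<\min(r,s)$, and $p,q>r,s$ is shorthand for $\min(p,q)>\max(r,s)$. For a permutation $\pi$ in $S_4$ (the permutations of $\{1,2,3,4\}$) write $z_{\pi(1,2,3,4)}=(z_{\pi(1)},z_{\pi(2)},z_{\pi(3)},z_{\pi(4)})$, and define the symmetric kernel $$h((x_1,y_1),\dots,(x_4,y_4)) = \frac{1}{4!}\sum_{\pi\in S_4} a(x_{\pi(1,2,3,4)})\,a(y_{\pi(1,2,3,4)}).$$ Define $h_1(x_1,y_1) = \mathrm{E}[h((x_1,y_1),(X_2,Y_2),(X_3,Y_3),(X_4,Y_4))]$. *)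

(* Defs.v *)
From HB Require Import structures.
From mathcomp Require Export all_boot all_order all_algebra perm.
From mathcomp Require Export all_classical all_reals all_analysis.

Set Implicit Arguments.
Unset Strict Implicit.
Unset Printing Implicit Defensive.
Import Order.TTheory GRing.Theory Num.Theory.
Import numFieldNormedType.Exports.

Local Open Scope classical_set_scope.
Local Open Scope ring_scope.

Section Independence.
Context {d : measure_display} {T : measurableType d} {R : realType}.
Variable P : probability T R.

Definition independent2 {d1 d2 : measure_display} {E1 : measurableType d1}
    {E2 : measurableType d2} (X : T -> E1) (Y : T -> E2) : Prop :=
  forall (A : set E1) (B : set E2), measurable A -> measurable B ->
    (P (X @^-1` A `&` Y @^-1` B) = P (X @^-1` A) * P (Y @^-1` B))%E.

Definition mutually_independent {I : finType} {d1 : measure_display}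
    {E : measurableType d1} (Z : I -> T -> E) : Prop :=
  forall (J : {set I}) (A : I -> set E), (forall i, measurable (A i)) ->
    (P (\bigcap_(i in [set j | j \in J]) (Z i @^-1` A i)) =
     \prod_(i in J) P (Z i @^-1` A i))%E.

End Independence.

(* The copies may live on another probability space than the original. *)
Definition iid_copies {R : realType}
    {d0 : measure_display} {T0 : measurableType d0} (P0 : probability T0 R)
    {d : measure_display} {T : measurableType d} (P : probability T R)
    {d1 : measure_display} {E : measurableType d1} {I : finType}
    (V : T0 -> E) (Z : I -> T -> E) : Prop :=
  mutually_independent P Z /\
  forall (i : I) (A : set E), measurable A -> P (Z i @^-1` A) = P0 (V @^-1` A).

(* The indices 1, 2, 3, 4 of the mathematical text are shifted by one. *)
Definition i1 : 'I_4 := @Ordinal 4 0 isT.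
Definition i2 : 'I_4 := @Ordinal 4 1 isT.
Definition i3 : 'I_4 := @Ordinal 4 2 isT.
Definition i4 : 'I_4 := @Ordinal 4 3 isT.

Section Kernel.
Context {R : realType}.

(* I(p, q < r, s) and I(p, q > r, s) *)
Definition ind_lt (p q r s : R) : R := (Num.max p q < Num.min r s)%R%:R.
Definition ind_gt (p q r s : R) : R := (Num.min p q > Num.max r s)%R%:R.

Definition kernel_a (z1 z2 z3 z4 : R) : R :=
  ind_lt z1 z3 z2 z4 + ind_gt z1 z3 z2 z4
  - ind_lt z1 z2 z3 z4 - ind_gt z1 z2 z3 z4.

Definition kernel_a_perm (s : 'S_4) (z : 'I_4 -> R) : R :=
  kernel_a (z (s i1)) (z (s i2)) (z (s i3)) (z (s i4)).

Definition kernel_h (p1 p2 p3 p4 : R * R) : R :=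
  let p := tnth [tuple p1; p2; p3; p4] in
  (4`!)%:R^-1 *
  \sum_(s : 'S_4) kernel_a_perm s (fun i => (p i).1) *
                  kernel_a_perm s (fun i => (p i).2).

(* [fine] is harmless: [kernel_h] is bounded and measurable. *)
Definition kernel_h1 {d : measure_display} {T : measurableType d}
    (P : probability T R) (Z : 'I_4 -> T -> R * R) (p : R * R) : R :=
  fine ('E_P[fun w => kernel_h p (Z i2 w) (Z i3 w) (Z i4 w)])%E.

End Kernel.

(* Main.v *)
Require Import Defs.
From mathcomp Require Import ring measurable_realfun.
Set Implicit Arguments.
Unset Strict Implicit.
Unset Printing Implicit Defensive.
Import Order.TTheory GRing.Theory Num.Theory.
Import numFieldNormedType.Exports.
Local Open Scope classical_set_scope.
Local Open Scope ring_scope.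

(** The function [kernel_h1] vanishes identically, and this is a symmetry
    argument. Fix the first point [p], and consider one summand
    [a(x_s) a(y_s)] of the kernel, for a permutation [s]. The function [a]
    changes sign when its two inner arguments are exchanged, and also when its
    two outer arguments are exchanged. Position-wise these two transpositions
    are disjoint, so at least one of them leaves in place the argument that
    carries the fixed point [p]: it exchanges two of the three random points
    ([kernel_a_perm_antisym]).

    Exchange accordingly the abscissas of these two random points, and only the
    abscissas. The factor in [x] changes sign and the factor in [y] does not
    change. On the other hand, since the copies are i.i.d. and [X] and [Y] are
    independent, the six coordinates of the three random points are mutually
    independent, the abscissas having a common law; the joint law of the three
    points is therefore unaffected ([shuffle_law]). So the mean of the summand
    is equal to its opposite, and it is zero.

    Equality of the joint laws is checked on boxes, where both probabilities
    are the same product ([shuffled_box]), and then extended by the uniqueness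
    of measures on a generating pi-system ([eq_law_generating]). *)

(** * Laws determined by a pi-system *)

(** The whole space is required to belong to [G] for two reasons: factors of a
    box can then be left unconstrained, and finite measures that agree on [G]
    have the same total mass. *)
Definition generating_pi_system {d : measure_display} {E : measurableType d}
    (G : set (set E)) : Prop :=
  [/\ setI_closed G, G setT & d.-measurable = <<s G>>].

Lemma generating_pi_system_measurable {d : measure_display}
    (E : measurableType d) : generating_pi_system (@measurable d E).
Proof.
split; [exact: measurableI | exact: measurableT |].
by rewrite sigma_algebra_id//; exact: sigma_algebra_measurable.
Qed.

(** Cylinders over members of [G1] are boxes because [G2] contains the whole
    space, so both projections are measurable for the sigma-algebra that the
    boxes generate. Iterating the lemma gives boxes in any finite product. *)
Lemma generating_pi_system_prod {d1 d2 : measure_display}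
    (E1 : measurableType d1) (E2 : measurableType d2)
    (G1 : set (set E1)) (G2 : set (set E2)) :
  generating_pi_system G1 -> generating_pi_system G2 ->
  generating_pi_system [set A `*` B | A in G1 & B in G2].
Proof.
move=> [I1 T1 g1] [I2 T2 g2].
set G := [set A `*` B | A in G1 & B in G2].
pose F := g_sigma_algebraType G.
have mfst : measurable_fun setT (fst : F -> E1).
  apply: (measurability G1) => // _ [A GA <-]; rewrite setTI.
  apply: sub_sigma_algebra; exists A => //; exists setT => //.
  by apply/seteqP; split => -[x y] //= [].
have msnd : measurable_fun setT (snd : F -> E2).
  apply: (measurability G2) => // _ [B GB <-]; rewrite setTI.
  apply: sub_sigma_algebra; exists setT => //; exists B => //.
  by apply/seteqP; split => -[x y] //= [].
split.
- move=> _ _ [A GA [B GB <-]] [A' GA' [B' GB' <-]].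
  exists (A `&` A'); first exact: I1.
  by exists (B `&` B'); [exact: I2 | rewrite setXI].
- by exists setT => //; exists setT => //; rewrite setXTT.
rewrite measurable_prod_measurableType; apply/seteqP; split.
  apply: smallest_sub => [|_ [A mA [B mB <-]]].
    exact: smallest_sigma_algebra.
  have := @measurableI _ F _ _ (mfst measurableT A mA) (msnd measurableT B mB).
  by rewrite !setTI.
apply: smallest_sub => [|_ [A GA [B GB <-]]].
  exact: smallest_sigma_algebra.
by apply: sub_sigma_algebra; exists A; [|exists B => //]; rewrite ?g1 ?g2;
  exact: sub_sigma_algebra.
Qed.

Lemma eq_law_generating {R : realType} {d d' : measure_display}
    {T : measurableType d} {E : measurableType d'} (P : probability T R)
    (f g : T -> E) (G : set (set E)) :
  generating_pi_system G -> measurable_fun setT f -> measurable_fun setT g ->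
  (forall A, G A -> P (f @^-1` A) = P (g @^-1` A)) ->
  forall A, measurable A -> P (f @^-1` A) = P (g @^-1` A).
Proof.
move=> [GI GT gG] mf mg fg A mA.
(* The measure structure on a pushforward takes a proof of measurability that
   unification cannot guess, so the instance is applied explicitly. *)
pose law f mf :=
  @measure_function_pushforward__canonical__measure_function_Measure
    _ _ T E R P f mf.
apply: (measure_unique G (fun=> setT) gG GI _ _ (law f mf) (law g mg)) => //.
- by rewrite bigcup_const.
- move=> _; change (P (f @^-1` setT) < +oo)%E.
  by rewrite preimage_setT probability_setT ltry.
Qed.

Lemma bounded_integrable {R : realType} {d : measure_display}
    {T : measurableType d} (P : probability T R) (u : T -> R) (c : R) :
  measurable_fun setT u -> (forall x, `|u x| <= c) ->
  P.-integrable setT (EFin \o u).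
Proof.
move=> mu uc; apply: measurable_bounded_integrable => //.
  by apply: (le_lt_trans (probability_le1 P measurableT)); rewrite ltry.
exists c; split; first exact: num_real.
by move=> M cM x _ /=; rewrite (le_trans (uc x))// ltW.
Qed.

Lemma eq_law_integral {R : realType} {d d' : measure_display}
    {T : measurableType d} {E : measurableType d'} (P : probability T R)
    (f g : T -> E) (u : E -> R) (c : R) :
  measurable_fun setT f -> measurable_fun setT g -> measurable_fun setT u ->
  (forall x, `|u x| <= c) ->
  (forall A, measurable A -> P (f @^-1` A) = P (g @^-1` A)) ->
  (\int[P]_w (u (f w))%:E = \int[P]_w (u (g w))%:E)%E.
Proof.
move=> mf mg mu uc fg.
pose law f mf :=
  @measure_function_pushforward__canonical__measure_function_Measure
    _ _ T E R P f mf.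
have intE h (mh : measurable_fun setT h) :
    (\int[P]_w (u (h w))%:E = \int[law h mh]_x (u x)%:E)%E.
  rewrite (integral_pushforward mh (f := EFin \o u))//.
  - exact/measurable_EFinP.
  - rewrite preimage_setT; apply: (@bounded_integrable _ _ _ _ (u \o h) c) => //.
      exact: measurableT_comp.
    by move=> x /=.
rewrite (intE f mf) (intE g mg); apply: eq_measure_integral => A mA _.
exact: fg.
Qed.

(** * Symmetries of the kernel *)

Section kernel.
Context {R : realType}.
Implicit Types z : 'I_4 -> R.

(** The inner exchange turns the pairing 13|24 into 12|34: it permutes the two
    positive terms of [kernel_a] with the two negative ones. *)
Lemma kernel_a_swap_inner (z1 z2 z3 z4 : R) :
  kernel_a z1 z3 z2 z4 = - kernel_a z1 z2 z3 z4.
Proof. rewrite /kernel_a; ring. Qed.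

(** The outer exchange also swaps the two pairings, but it exchanges their
    lower and upper halves as well, so that the [ind_lt] terms correspond to
    the [ind_gt] terms. *)
Lemma kernel_a_swap_outer (z1 z2 z3 z4 : R) :
  kernel_a z4 z2 z3 z1 = - kernel_a z1 z2 z3 z4.
Proof.
rewrite /kernel_a /ind_lt /ind_gt.
rewrite (maxC z4 z3) (minC z2 z1) (minC z4 z3) (maxC z2 z1).
rewrite (maxC z4 z2) (minC z3 z1) (minC z4 z2) (maxC z3 z1).
ring.
Qed.

(** Whatever index [k] is to be kept in place, [t] can be taken to be the inner
    or the outer transposition, read through [s]: these two have disjoint
    supports. *)
Lemma kernel_a_perm_antisym (s : 'S_4) (k : 'I_4) :
  exists2 t : 'S_4, t k = k &
    forall z, kernel_a_perm s (z \o t) = - kernel_a_perm s z.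
Proof.
have ne i j : i != j -> s i != s j by rewrite (inj_eq perm_inj).
case: (boolP ((k == s i2) || (k == s i3))) => [kin|].
  exists (tperm (s i1) (s i4)).
    by apply: tpermD; case/orP: kin => /eqP ->; exact: ne.
  move=> z; rewrite /kernel_a_perm/= tpermL tpermR !tpermD; try exact: ne.
  exact: kernel_a_swap_outer.
rewrite negb_or => /andP[k2 k3]; exists (tperm (s i2) (s i3)).
  by rewrite tpermD// eq_sym.
move=> z; rewrite /kernel_a_perm/= tpermL tpermR !tpermD; try exact: ne.
exact: kernel_a_swap_inner.
Qed.

Lemma normr_kernel_a_le (z1 z2 z3 z4 : R) : `|kernel_a z1 z2 z3 z4| <= 4.
Proof.
have b01 (b : bool) : `|b%:R : R| <= 1 by case: b; rewrite ?normr1 ?normr0.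
rewrite (_ : 4 = 1 + 1 + 1 + 1); last by ring.
rewrite /kernel_a.
apply: (le_trans (ler_normB _ _)); apply: lerD; last exact: b01.
apply: (le_trans (ler_normB _ _)); apply: lerD; last exact: b01.
by apply: (le_trans (ler_normD _ _)); apply: lerD; exact: b01.
Qed.

Lemma measurable_kernel_a_perm {d : measure_display} {E : measurableType d}
    (s : 'S_4) (z : E -> 'I_4 -> R) :
  (forall i, measurable_fun setT (z ^~ i)) ->
  measurable_fun setT (fun x => kernel_a_perm s (z x)).
Proof.
move=> mz.
have mb (b : E -> bool) : measurable_fun setT b ->
    measurable_fun setT (fun x => (b x)%:R : R).
  by move=> ?; apply: (measurableT_comp (f := fun b : bool => b%:R : R)).
have lt (f g h k : E -> R) : measurable_fun setT f -> measurable_fun setT g ->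
    measurable_fun setT h -> measurable_fun setT k ->
    measurable_fun setT (fun x => ind_lt (f x) (g x) (h x) (k x)).
  move=> *; apply: (mb (fun x => Num.max (f x) (g x) < Num.min (h x) (k x))).
  by apply: measurable_fun_ltr; [exact: measurable_maxr|exact: measurable_minr].
have gt (f g h k : E -> R) : measurable_fun setT f -> measurable_fun setT g ->
    measurable_fun setT h -> measurable_fun setT k ->
    measurable_fun setT (fun x => ind_gt (f x) (g x) (h x) (k x)).
  move=> *; apply: (mb (fun x => Num.max (h x) (k x) < Num.min (f x) (g x))).
  by apply: measurable_fun_ltr; [exact: measurable_maxr|exact: measurable_minr].
rewrite /kernel_a_perm /kernel_a.
apply: measurable_funB; last exact: gt.
apply: measurable_funB; last exact: lt.
by apply: measurable_funD; [exact: lt | exact: gt].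
Qed.

End kernel.

(** * Shuffling the first coordinates of the copies *)

(** The right-hand side does not mention [t]: the abscissa of copy [t i] has the
    same law for all [i]. The event is a box for the original copies, namely
    that copy [i] lies in [A (t^-1 i) `*` B i], which gives the factorization. *)
Lemma shuffled_box {R : realType}
    {d0 : measure_display} {T0 : measurableType d0} (P0 : probability T0 R)
    {d : measure_display} {T : measurableType d} (P : probability T R)
    {d1 d2 : measure_display} {E1 : measurableType d1} {E2 : measurableType d2}
    {I : finType} (X : T0 -> E1) (Y : T0 -> E2) (Z : I -> T -> E1 * E2)
    (t : {perm I}) (A : I -> set E1) (B : I -> set E2) :
  iid_copies P0 P (fun w => (X w, Y w)) Z -> independent2 P0 X Y ->
  (forall i, measurable (A i)) -> (forall i, measurable (B i)) ->
  (P [set w | forall i, A i (Z (t i) w).1 /\ B i (Z i w).2] =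
   \prod_i P0 (X @^-1` A i) * \prod_i P0 (Y @^-1` B i))%E.
Proof.
move=> [indZ lawZ] indXY mA mB.
pose C i := A (t^-1%g i) `*` B i.
have mC i : measurable (C i) by exact: measurableX.
have -> : [set w | forall i, A i (Z (t i) w).1 /\ B i (Z i w).2] =
    \bigcap_(i in [set j | j \in [set: I]%SET]) (Z i @^-1` C i).
  apply/seteqP; split => w /= h i.
    by move=> _; have [] := h (t^-1%g i); have [] := h i; rewrite permKV.
  split; last by have [] := h i (finset.in_setT i).
  by have [+ _] := h (t i) (finset.in_setT _); rewrite permK.
rewrite indZ//; under eq_bigl do rewrite finset.in_setT.
under eq_bigr => i _.
  rewrite lawZ// (_ : _ @^-1` _ = X @^-1` A (t^-1%g i) `&` Y @^-1` B i)//.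
  rewrite indXY//; over.
rewrite big_split/=; congr (_ * _)%E.
by rewrite (reindex_inj (@perm_inj _ t))/=; under eq_bigr do rewrite permK.
Qed.

Section shuffle.
Context {R : realType}.
Local Notation RR := (R * R)%type.

Definition quadruple (p : RR) (q : RR * (RR * RR)) (i : 'I_4) : RR :=
  tnth [tuple p; q.1; q.2.1; q.2.2] i.

Lemma measurable_quadruple (p : RR) (i : 'I_4) :
  measurable_fun setT (fun q => quadruple p q i).
Proof.
have m2 : measurable_fun setT (snd : RR * (RR * RR) -> RR * RR).
  exact: measurable_snd.
case: i => -[|[|[|[|//]]]] i /=.
- exact: measurable_cst.
- exact: measurable_fst.
- exact: (measurableT_comp measurable_fst m2).
- exact: (measurableT_comp measurable_snd m2).
Qed.

Context {d : measure_display} {T : measurableType d}.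
Variable (P : probability T R) (Z : 'I_4 -> {RV P >-> RR}).

Definition shuffle (t : 'S_4) (w : T) : RR * (RR * RR) :=
  let q i := ((Z (t i) w).1, (Z i w).2) in (q i2, (q i3, q i4)).

Lemma quadruple_shuffle (t : 'S_4) (w : T) (p : RR) (i : 'I_4) :
  quadruple p (shuffle t w) i =
  if i == i1 then p else ((Z (t i) w).1, (Z i w).2).
Proof. by case: i => -[|[|[|[|//]]]] i; rewrite (bool_irrelevance i isT). Qed.

Lemma measurable_shuffle (t : 'S_4) :
  measurable_fun setT (shuffle t).
Proof.
have mq i : measurable_fun setT (fun w => ((Z (t i) w).1, (Z i w).2)).
  apply/measurable_fun_pair.
    exact: (measurableT_comp measurable_fst).
  exact: (measurableT_comp measurable_snd).
by do 2 (apply/measurable_fun_pair => //).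
Qed.

(** Only the copies [i2], [i3], [i4] are observed, so the index [i1] is given the
    trivial constraint [setT] when the box is described over all four indices. *)
Lemma shuffle_law {d0 : measure_display} {T0 : measurableType d0}
    (P0 : probability T0 R) (X Y : {RV P0 >-> R}) (t t' : 'S_4) :
  iid_copies P0 P (fun w => (X w, Y w)) (fun i => Z i : T -> RR) ->
  independent2 P0 X Y ->
  forall C, measurable C ->
    P (shuffle t @^-1` C) = P (shuffle t' @^-1` C).
Proof.
move=> copies indXY.
have G2 := generating_pi_system_prod (generating_pi_system_measurable R)
  (generating_pi_system_measurable R).
apply: (eq_law_generating
  (generating_pi_system_prod G2 (generating_pi_system_prod G2 G2)));
  try exact: measurable_shuffle.
move=> _ [_ [A2 mA2 [B2 mB2 <-]]
  [_ [_ [A3 mA3 [B3 mB3 <-]] [_ [A4 mA4 [B4 mB4 <-]] <-]] <-]].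
pose A (i : 'I_4) := nth setT [:: setT; A2; A3; A4] i.
pose B (i : 'I_4) := nth setT [:: setT; B2; B3; B4] i.
have mA i : measurable (A i).
  by case: i => -[|[|[|[|//]]]] i; rewrite /A/=; [exact: measurableT|..].
have mB i : measurable (B i).
  by case: i => -[|[|[|[|//]]]] i; rewrite /B/=; [exact: measurableT|..].
have boxE (u : 'S_4) : shuffle u @^-1`
      ((A2 `*` B2) `*` ((A3 `*` B3) `*` (A4 `*` B4))) =
    [set w | forall i, A i (Z (u i) w).1 /\ B i (Z i w).2].
  apply/seteqP; split=> w /= => [[[? ?] [[? ?] [? ?]]] i|h].
    case: i => -[|[|[|[|//]]]] i; rewrite ?(bool_irrelevance i isT) //.
  by split; [|split]; [exact: (h i2)|exact: (h i3)|exact: (h i4)].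
by rewrite !boxE !(shuffled_box _ copies indXY mA mB).
Qed.

End shuffle.

(** * Degeneracy of the first projection *)

Theorem lemma3p2 (R : realType)
    (d0 : measure_display) (T0 : measurableType d0) (P0 : probability T0 R)
    (X Y : {RV P0 >-> R})
    (d : measure_display) (T : measurableType d) (P : probability T R)
    (Z : 'I_4 -> {RV P >-> (R * R)%type})
    (copies : iid_copies P0 P (fun w => (X w, Y w)) (fun i => Z i : T -> R * R))
    (XY_indep : independent2 P0 X Y) :
  ('V_P[fun w => kernel_h1 P Z (Z i1 w)] = 0)%E /\
  exists c : R, {ae P, forall w, kernel_h1 P Z (Z i1 w) = c}.
Proof.
suff h1_0 p : kernel_h1 P Z p = 0.
  split; last by exists 0; apply: aeW => w; exact: h1_0.
  by under eq_fun do rewrite h1_0; exact: variance_cst.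
pose W := shuffle Z.
pose term s q : R := kernel_a_perm s (fun i => (quadruple p q i).1) *
                     kernel_a_perm s (fun i => (quadruple p q i).2).
have mterm s : measurable_fun setT (term s).
  by apply: (@measurable_funM _ _ R setT
    (fun q => kernel_a_perm s (fun i => (quadruple p q i).1))
    (fun q => kernel_a_perm s (fun i => (quadruple p q i).2)));
    apply: measurable_kernel_a_perm => i; apply: measurableT_comp => //;
    exact: measurable_quadruple.
have term_le s q : `|term s q| <= 16.
  rewrite normrM (_ : 16 = 4 * 4); last by ring.
  by apply: ler_pM => //; exact: normr_kernel_a_le.
have int_term s : P.-integrable setT (fun w => (term s (W 1%g w))%:E).
  apply: (@bounded_integrable R d T P (term s \o W 1%g) 16) => [|w].
    by apply: (measurableT_comp (mterm s)); exact: measurable_shuffle.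
  exact: term_le.
have mean_term s : (\int[P]_w (term s (W 1%g w))%:E = 0)%E.
  have [t ti1 tN] := @kernel_a_perm_antisym R s i1.
  (* As [t] fixes [i1], moving abscissas along [t] leaves [p] in place. *)
  have flip w : term s (W t w) = - term s (W 1%g w).
    rewrite /term -mulNr -tN; congr (kernel_a_perm s _ * kernel_a_perm s _).
      apply/funext => i; rewrite /= !quadruple_shuffle perm1.
      by rewrite -(inj_eq (@perm_inj _ t) i) ti1; case: ifP.
    by apply/funext => i; rewrite !quadruple_shuffle; case: ifP.
  have /= := eq_law_integral (measurable_shuffle Z 1%g) (measurable_shuffle Z t)
    (mterm s) (term_le s) (shuffle_law _ _ copies XY_indep).
  rewrite -/W; set I := (\int[P]_w (term s (W 1%g w))%:E)%E.
  under [in RHS]eq_integral do rewrite flip EFinN.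
  rewrite integralN; last exact: integrable_add_def.
  rewrite -/I; have : I \is a fin_num by exact: integrable_fin_num.
  move=> /fineK <-; rewrite -EFinN => -[/eqP]; rewrite -addr_eq0 -mulr2n.
  by rewrite mulrn_eq0/= => /eqP ->.
rewrite /kernel_h1 unlock.
have h_sum w : kernel_h p (Z i2 w) (Z i3 w) (Z i4 w) =
    (4`!)%:R^-1 * \sum_s term s (W 1%g w).
  rewrite /kernel_h; congr (_ * _); apply: eq_bigr => s _; rewrite /term.
  congr (kernel_a_perm s _ * kernel_a_perm s _); apply/funext => i;
    rewrite quadruple_shuffle perm1;
    by case: i => -[|[|[|[|//]]]] i; rewrite (bool_irrelevance i isT).
under eq_integral do rewrite h_sum EFinM -sumEFin.
rewrite integralZl//; last exact: integrable_sum.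
by rewrite integral_sum// big1 ?mule0.
Qed.
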